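(* For every integer $n\geq 2$ and every $q\in\mathbb{H}$, $$\Delta(q^n)=-4\sum_{k=1}^{n-1}(n-k)\,q^{n-k-1}\,\overline{q}^{\,k-1},$$ i.e. the image $\tau[f_n]$ of the monomial $f_n(q)=q^n$ under the Fueter mapping $\tau=\Delta$ is the function on the right-hand side.
   Context: $\mathbb{H}$ denotes the quaternions, $q=x_0+x_1i+x_2j+x_3k$, $\overline q=x_0-x_1i-x_2j-x_3k$. $\Delta=\sum_{l=0}^3\partial_{x_l}^2$ is the Laplacian on $\mathbb{R}^4\cong\mathbb{H}$, applied componentwise to $\mathbb{H}$-valued functions. The Fueter mapping is $\tau(f)=\Delta f$ on slice hyperholomorphic functions. *)

(* Defs.v *)
From HB Require Import structures.
From mathcomp Require Import all_boot all_order all_algebra ring.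
From mathcomp Require Import all_classical all_reals all_analysis.

Set Implicit Arguments.
Unset Strict Implicit.
Unset Printing Implicit Defensive.

Import Order.TTheory GRing.Theory Num.Theory.
Import numFieldNormedType.Exports.

Local Open Scope ring_scope.

(* x_0 + x_1 i + x_2 j + x_3 k is the row vector (x_0, x_1, x_2, x_3).
   Pitfall: the inherited norm is the sup norm of 'rV[R]_4, not the quaternion
   modulus; it is only used through the topology it induces. *)
Definition quat (R : realType) : Type := 'rV[R]_4.

HB.instance Definition _ (R : realType) :=
  NormedModule.copy (quat R) 'rV[R]_4.

Definition mkquat (R : realType) (a b c d : R) : quat R :=
  (\row_(l < 4) [:: a; b; c; d]`_l : 'rV[R]_4).

Definition quat_coord (R : realType) (l : 'I_4) (q : quat R) : R :=
  (q : 'rV[R]_4) 0 l.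

Section QuaternionRing.
Variable R : realType.
Implicit Types p q r : quat R.

Let re q : R := quat_coord (@Ordinal 4 0 isT) q.
Let im_i q : R := quat_coord (@Ordinal 4 1 isT) q.
Let im_j q : R := quat_coord (@Ordinal 4 2 isT) q.
Let im_k q : R := quat_coord (@Ordinal 4 3 isT) q.

Definition quat_one : quat R := mkquat 1 0 0 0.

Definition quat_mul p q : quat R :=
  mkquat
    (re p * re q - im_i p * im_i q - im_j p * im_j q - im_k p * im_k q)
    (re p * im_i q + im_i p * re q + im_j p * im_k q - im_k p * im_j q)
    (re p * im_j q - im_i p * im_k q + im_j p * re q + im_k p * im_i q)
    (re p * im_k q + im_i p * im_j q - im_j p * im_i q + im_k p * re q).

Definition quat_conj q : quat R :=
  mkquat (re q) (- im_i q) (- im_j q) (- im_k q).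

Lemma quatP p q :
  [/\ re p = re q, im_i p = im_i q, im_j p = im_j q & im_k p = im_k q] -> p = q.
Proof.
case=> h0 h1 h2 h3; apply/rowP => l.
by case: l => [[|[|[|[|//]]]] hl]; rewrite (bool_irrelevance hl isT).
Qed.

Lemma coordD l p q : quat_coord l (p + q) = quat_coord l p + quat_coord l q.
Proof. exact: mxE. Qed.

Lemma coord_mkquat l (a b c d : R) :
  quat_coord l (mkquat a b c d) = [:: a; b; c; d]`_l.
Proof. exact: mxE. Qed.

Local Ltac quat_ring :=
  rewrite /quat_mul /re /im_i /im_j /im_k !(coordD, coord_mkquat) /=; ring.

Fact quat_mulA : associative quat_mul.
Proof. by move=> p q r; apply: quatP; split; quat_ring. Qed.

Fact quat_mul1l : left_id quat_one quat_mul.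
Proof. by move=> p; apply: quatP; split; quat_ring. Qed.

Fact quat_mul1r : right_id quat_one quat_mul.
Proof. by move=> p; apply: quatP; split; quat_ring. Qed.

Fact quat_mulDl : left_distributive quat_mul +%R.
Proof. by move=> p q r; apply: quatP; split; quat_ring. Qed.

Fact quat_mulDr : right_distributive quat_mul +%R.
Proof. by move=> p q r; apply: quatP; split; quat_ring. Qed.

Fact quat_one_neq0 : quat_one != 0.
Proof.
apply/eqP => /(congr1 (quat_coord (@Ordinal 4 0 isT))).
rewrite coord_mkquat => /eqP.
by rewrite /quat_coord mxE oner_eq0.
Qed.

End QuaternionRing.

HB.instance Definition _ (R : realType) :=
  GRing.Zmodule_isNzRing.Build (quat R) (@quat_mulA R) (@quat_mul1l R)
    (@quat_mul1r R) (@quat_mulDl R) (@quat_mulDr R) (@quat_one_neq0 R).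

Definition quat_basis (R : realType) (l : 'I_4) : quat R :=
  (delta_mx 0 l : 'rV[R]_4).

Definition laplacianR (R : realType) (g : quat R -> R) (q : quat R) : R :=
  \sum_(l < 4) 'D_(quat_basis R l) ('D_(quat_basis R l) g) q.

Definition laplacian (R : realType) (f : quat R -> quat R) (q : quat R) :
    quat R :=
  (\row_(m < 4) laplacianR (fun p => quat_coord m (f p)) q : 'rV[R]_4).

(* The Fueter mapping is the restriction of the Laplacian to slice
   hyperholomorphic functions; it is given here by its formula on all
   functions. *)
Definition fueter_map (R : realType) (f : quat R -> quat R) : quat R -> quat R :=
  laplacian f.

Definition monomial (R : realType) (n : nat) (q : quat R) : quat R := q ^+ n.

(* Main.v *)
Require Import Defs.
From mathcomp Require Import all_boot all_order all_algebra.
From mathcomp Require Import all_classical all_reals all_analysis.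
From mathcomp Require Import ring.
Import GRing.Theory.
Local Open Scope ring_scope.

(** Write e_0, ..., e_3 for the basis 1, i, j, k, d_l for the partial
    derivative along e_l, and c for the conjugate of q.  Since quaternions do
    not commute, the Leibniz rule gives
      [d_l (q^n) = \sum_(i < n) q^i e_l q^(n-1-i)]
    and, differentiating [q^(n+1) = q^n q] twice and summing over l,
      [Delta (q^(n+1)) = Delta (q^n) q + 2 \sum_l d_l (q^n) e_l],
    as the second derivatives of q itself vanish.

    The last sum is where the conjugate appears: for every quaternion x,
      [\sum_l e_l x e_l = - 2 (conjugate of x)]    (lemma [sum_basis_mul]),
    so that [\sum_l d_l (q^n) e_l = - 2 \sum_(i < n) q^i c^(n-1-i)].  The
    resulting recursion
      [Delta (q^(n+1)) = Delta (q^n) q - 4 \sum_(i < n) q^i c^(n-1-i)]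
    is the one satisfied by the claimed closed form: as q and c commute, its
    right multiplication by q raises each exponent of q by one, and the second
    sum raises each coefficient [n - k] to [n + 1 - k]. *)

Section QuaternionPowers.
Set Implicit Arguments.
Unset Strict Implicit.
Variable R : realType.
Implicit Types (l m : 'I_4) (f g : quat R -> quat R) (p q x : quat R) (n : nat).
Notation e l := (quat_basis R l).

(** * Partial derivatives of quaternion-valued functions *)

(** Stated coordinatewise because the Laplacian is: this reduces the Leibniz
    rule for the quaternion product to that for products of real functions,
    without appeal to the continuity of the quaternion product. *)
Definition has_pderiv l f df :=
  forall m q, is_derive q (e l) (fun p => quat_coord m (f p))
                        (quat_coord m (df q)).

Lemma quat_mulE p q : p * q = quat_mul p q.
Proof. by []. Qed.

Lemma coord_sum m (F : 'I_4 -> quat R) :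
  quat_coord m (\sum_i F i) = \sum_i quat_coord m (F i).
Proof. exact: summxE. Qed.

Lemma has_pderivD l f g df dg :
  has_pderiv l f df -> has_pderiv l g dg ->
  has_pderiv l (fun p => f p + g p) (fun p => df p + dg p).
Proof.
move=> hf hg m q.
under eq_fun do rewrite coordD.
by rewrite coordD; exact: is_deriveD (hf m q) (hg m q).
Qed.

(** Each coordinate of a quaternion product is a signed sum of four products of
    coordinates; the four cases below follow the sign pattern of each row of
    the multiplication table. *)
Lemma has_pderivM l f g df dg :
  has_pderiv l f df -> has_pderiv l g dg ->
  has_pderiv l (fun p => f p * g p) (fun p => df p * g p + f p * dg p).
Proof.
move=> hf hg m q.
have hfg a b : is_derive q (e l)
    (fun p => quat_coord a (f p) * quat_coord b (g p))
    (quat_coord a (df q) * quat_coord b (g q)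
      + quat_coord a (f q) * quat_coord b (dg q)).
  apply: is_derive_eq (is_deriveM (hf a q) (hg b q)) _.
  by rewrite addrC; congr (_ + _); rewrite [LHS]mulrC.
rewrite coordD.
under eq_fun do rewrite quat_mulE coord_mkquat.
rewrite !quat_mulE !coord_mkquat.
case: m => [[|[|[|[|//]]]] hm] /=.
- apply: is_derive_eq (is_deriveB (is_deriveB (is_deriveB
    (hfg _ _) (hfg _ _)) (hfg _ _)) (hfg _ _)) _.
  ring.
- apply: is_derive_eq (is_deriveB (is_deriveD (is_deriveD
    (hfg _ _) (hfg _ _)) (hfg _ _)) (hfg _ _)) _.
  ring.
- apply: is_derive_eq (is_deriveD (is_deriveD (is_deriveB
    (hfg _ _) (hfg _ _)) (hfg _ _)) (hfg _ _)) _.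
  ring.
- apply: is_derive_eq (is_deriveD (is_deriveB (is_deriveD
    (hfg _ _) (hfg _ _)) (hfg _ _)) (hfg _ _)) _.
  ring.
Qed.

Lemma has_pderiv_cst l q : has_pderiv l (fun=> q) (fun=> 0).
Proof.
move=> m p; apply: is_derive_eq (is_derive_cst (quat_coord m q) p (e l)) _.
by rewrite /quat_coord mxE.
Qed.

Lemma has_pderiv_id l : has_pderiv l id (fun=> e l).
Proof.
move=> m q; have h := is_derive_id q (e l).
have hd := @ex_derive _ _ _ _ _ _ _ h.
split; first by have /derivable_mxP := hd; apply.
have /= hD := derive_mx hd.
by rewrite derive_val in hD; rewrite /quat_coord [in RHS]hD mxE.
Qed.

(** The first derivatives are needed at every point, as functions, because the
    Laplacian differentiates them again. *)
Lemma laplacian_pderiv f (df ddf : 'I_4 -> quat R -> quat R) q :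
  (forall l, has_pderiv l f (df l)) ->
  (forall l, has_pderiv l (df l) (ddf l)) ->
  laplacian f q = \sum_l ddf l q.
Proof.
move=> hf hdf; apply/rowP => m; rewrite mxE [RHS]coord_sum.
apply: eq_bigr => l _.
have -> : 'D_(e l) (fun p => quat_coord m (f p))
    = (fun p => quat_coord m (df l p)).
  by apply/funext => p; have h := hf l m p; rewrite derive_val.
by have h := hdf l m q; rewrite derive_val.
Qed.

(** * Derivatives of the powers *)

Definition pderivX l n q : quat R :=
  \sum_(i < n) q ^+ i * e l * q ^+ (n - i.+1).

Lemma pderivX0 l : pderivX l 0 = fun=> 0.
Proof. by apply/funext => q; exact: big_ord0. Qed.

Lemma pderivXS l n :
  pderivX l n.+1 = fun q => pderivX l n q * q + q ^+ n * e l.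
Proof.
apply/funext => q.
rewrite /pderivX big_ord_recr /= subnn expr0 mulr1; congr (_ + _).
rewrite mulr_suml; apply: eq_bigr => i _.
by rewrite -!mulrA -exprSr subSS subnSK.
Qed.

Lemma has_pderivX l n : has_pderiv l (fun q => q ^+ n) (pderivX l n).
Proof.
elim: n => [|n IHn]; first by rewrite pderivX0; exact: has_pderiv_cst.
under eq_fun do rewrite exprSr.
by rewrite pderivXS; exact: has_pderivM IHn (has_pderiv_id l).
Qed.

(** The second derivative is kept as a recursion rather than as a double sum:
    summed over [l], it is the recursion that determines the Laplacian. *)
Fixpoint pderiv2X l n q : quat R :=
  if n is n'.+1 then pderiv2X l n' q * q + 2%:R * (pderivX l n' q * e l) else 0.

Lemma has_pderiv2X l n : has_pderiv l (pderivX l n) (pderiv2X l n).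
Proof.
elim: n => [|n IHn]; first by rewrite pderivX0; exact: has_pderiv_cst.
rewrite pderivXS => m q /=.
have := has_pderivD (has_pderivM IHn (has_pderiv_id l))
  (has_pderivM (has_pderivX l n) (has_pderiv_cst l (e l))) m q.
by rewrite mulr0 addr0 -addrA mulr_natl mulr2n.
Qed.

(** * Summation over the basis *)

(** For [x = 1] the sum is [1 - 1 - 1 - 1 = - 2].  For [x] one of i, j, k, the
    term [e_l x e_l] is [x] at [e_l = 1], it is [- x] at [e_l = x], and it is
    [x] at the two other units, which anticommute with [x]: the total is [2 x].
    The general case follows by linearity in [x]. *)
Lemma sum_basis_mul x : \sum_l e l * x * e l = - 2%:R * quat_conj x.
Proof.
rewrite mulNr mulr_natl.
have coordN2 a : quat_coord a (- (quat_conj x *+ 2))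
    = - quat_coord a (quat_conj x) *+ 2.
  by rewrite mulNrn /quat_coord !mxE.
by apply: quatP; split; rewrite coord_sum coordN2 !big_ord_recl big_ord0
  !quat_mulE !coord_mkquat /= /quat_coord !mxE /=; ring.
Qed.

Lemma quat_conjX q n : quat_conj (q ^+ n) = quat_conj q ^+ n.
Proof.
elim: n => [|n IHn].
  by apply: quatP; split; rewrite !coord_mkquat /= ?oppr0.
(* Conjugation reverses products. *)
rewrite exprS exprSr -IHn !quat_mulE.
by apply: quatP; split; rewrite !coord_mkquat /=; ring.
Qed.

Lemma comm_quat_conj q : GRing.comm q (quat_conj q).
Proof.
rewrite /GRing.comm !quat_mulE.
by apply: quatP; split; rewrite !coord_mkquat /=; ring.
Qed.

(** In [q^i e_l q^(n-1-i) e_l] the factor [q^i] does not depend on [l], so that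
    [sum_basis_mul] applies with [x = q^(n-1-i)]. *)
Lemma sum_pderivX n q :
  \sum_l pderivX l n q * e l
    = - 2%:R * \sum_(i < n) q ^+ i * quat_conj q ^+ (n - i.+1).
Proof.
rewrite mulr_sumr; under eq_bigr do rewrite mulr_suml.
rewrite exchange_big; apply: eq_bigr => i _ /=.
under eq_bigr do rewrite -!mulrA.
rewrite -mulr_sumr; under eq_bigr do rewrite mulrA.
rewrite sum_basis_mul quat_conjX !mulrA; congr (_ * _).
by rewrite !(mulrN, mulNr) mulr_natl mulr_natr.
Qed.

Lemma sum_pderiv2X n q :
  \sum_l pderiv2X l n q = - 4%:R * \sum_(1 <= k < n)
         (n - k)%:R * q ^+ (n - k - 1) * quat_conj q ^+ (k - 1).
Proof.
elim: n => [|n IHn]; first by rewrite big_nil mulr0 big1.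
have -> : \sum_l pderiv2X l n.+1 q
    = - 4%:R * ((\sum_(1 <= k < n)
         (n - k)%:R * q ^+ (n - k - 1) * quat_conj q ^+ (k - 1)) * q
       + \sum_(i < n) q ^+ i * quat_conj q ^+ (n - i.+1)).
  rewrite /= big_split /= -mulr_suml -mulr_sumr IHn sum_pderivX mulrDr !mulrA.
  by rewrite mulrN -natrM.
congr (_ * _); rewrite big_add1 [in RHS]big_add1 /= !big_mkord.
have -> : (\sum_(i < n) q ^+ i * quat_conj q ^+ (n - i.+1))
  = \sum_(i < n) q ^+ (n - i.+1) * quat_conj q ^+ i.
  rewrite (reindex_inj rev_ord_inj) /=; apply: eq_bigr => i _.
  by rewrite subnSK // subKn // ltnW.
case: n IHn => [|n] _; first by rewrite !big_ord0 mul0r addr0.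
(* The two sums on the left have n and n + 1 terms: the extra one is the last
   term on the right, whose coefficient is 1. *)
rewrite !big_ord_recr /= mulr_suml addrA -big_split /=; congr (_ + _).
  apply: eq_bigr => i _; have hi := ltn_ord i.
  rewrite !subn1 /= !subSS (subSn (ltnW hi)) /=.
  rewrite -mulrA -(commrX i (comm_quat_conj q)).
  rewrite mulrA -(mulrA _ _ q) -exprSr prednK ?subn_gt0 //.
  by rewrite [in RHS]mulrSr mulrDl mul1r mulrDl.
by rewrite !subSS subSn // !subnn subn0 expr0 !mul1r.
Qed.

Lemma laplacianX n q :
  laplacian (fun p => p ^+ n) q = - 4%:R * \sum_(1 <= k < n)
    (n - k)%:R * q ^+ (n - k - 1) * quat_conj q ^+ (k - 1).
Proof.
rewrite -sum_pderiv2X.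
exact: (laplacian_pderiv (df := fun l => pderivX l n)
  q (fun l => has_pderivX l n) (fun l => has_pderiv2X l n)).
Qed.

End QuaternionPowers.

Theorem theorem3p2 (R : realType) (n : nat) (hn : (2 <= n)%N) :
  (forall q : quat R,
     laplacian (fun p : quat R => p ^+ n) q =
       - 4%:R * \sum_(1 <= k < n)
         (n - k)%:R * q ^+ (n - k - 1) * quat_conj q ^+ (k - 1)) /\
  fueter_map (@monomial R n) =
    (fun q : quat R =>
       - 4%:R * \sum_(1 <= k < n)
         (n - k)%:R * q ^+ (n - k - 1) * quat_conj q ^+ (k - 1)).
Proof.
by split=> [q|]; last apply/funext => q; exact: laplacianX.
Qed.
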